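(* Let $\mathcal{C}$ be a model category and let $f,g\colon A\to B$ be left or right homotopic morphisms in $\mathcal{C}$. Then $f_*$ and $g_*$ are simplicially homotopic maps, and $f^*$ and $g^*$ are simplicially homotopic maps. Here, for objects $X$ and $Y$ of $\mathcal{C}$, $f_*,g_*\colon \mathcal{L}^H\mathcal{C}(X,A)\to\mathcal{L}^H\mathcal{C}(X,B)$ and $f^*,g^*\colon \mathcal{L}^H\mathcal{C}(B,Y)\to\mathcal{L}^H\mathcal{C}(A,Y)$ are the induced maps of simplicial sets on the hammock localization of $\mathcal{C}$ with respect to its class of weak equivalences.
   Context: Hammock localization. Let $\mathcal{C}$ be a category with a class $\mathcal{W}$ of morphisms (weak equivalences) containing all identities; for a model category, $\mathcal{W}$ is its class of weak equivalences. For objects $X,Y$ and every odd natural number $n$, $\mathcal{L}^H_n\mathcal{C}(X,Y)$ is the category whose objects are zig-zags $X=C_0\xleftarrow{d_0}C_1\xrightarrow{d_1}\cdots\xrightarrow{d_{n-2}}C_{n-1}\xleftarrow{d_{n-1}}C_n=Y$ of $n$ morphisms in $\mathcal{C}$ with all arrows pointing left in $\mathcal{W}$, and whose morphisms are commutative diagrams between such zig-zags (given by morphisms $C_i\to C_i'$ of $\mathcal{C}$) that are identities on $C_0=X$ and $C_n=Y$. The hammock localization $\mathcal{L}^H\mathcal{C}$ is the simplicial category with the same objects as $\mathcal{C}$ and with $\mathcal{L}^H\mathcal{C}(X,Y)=\operatorname{colim}_n N\mathcal{L}^H_n\mathcal{C}(X,Y)$ ($N$ is the nerve, $n$ odd),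 where the sequential colimit is taken over the nerves of the embeddings $\mathcal{L}^H_n\mathcal{C}(X,Y)\to\mathcal{L}^H_{n+2}\mathcal{C}(X,Y)$ that replace $C_1$ by $C_1\xrightarrow{id}C_1\xleftarrow{id}C_1$. Composition is given by concatenation of zig-zags, composing the two adjacent backward arrows. For a morphism $f\colon A\to B$, the map $f^*$ is induced by the functors $\mathcal{L}^H_n\mathcal{C}(B,Y)\to\mathcal{L}^H_{n+2}\mathcal{C}(A,Y)$, $n$ odd, that send a zig-zag from $B$ to $Y$ to $A\xleftarrow{id}A\xrightarrow{f}B\xleftarrow{d_0}C_1\to\cdots\to C_{n-1}\leftarrow Y$. Similarly, $f_*$ is induced by the functors $\mathcal{L}^H_n\mathcal{C}(X,A)\to\mathcal{L}^H_{n+2}\mathcal{C}(X,B)$ that send a zig-zag from $X$ to $A$ to $X\leftarrow C_1\to\cdots\to C_{n-1}\xleftarrow{d_{n-1}}A\xrightarrow{f}B\xleftarrow{id}B$. Simplicial homotopy means the equivalence relation generated by strict simplicial homotopies. Left (respectively right) homotopies are those defined by cylinder (respectively path) objects in the model category. For categories that are not small, set-theoretical issues are handled using universes.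
   Formalization: The functors given for f^* do not commute with the embeddings, so f^* is undefined on the stated colimit. The formal claim for f^* is for maps from the coproduct of all stages N L^H_n C(B,Y) to L^H C(A,Y), and for hammocks modulo omitting identity columns (Dwyer–Kan). *)

(* Defs.v *)
From HB Require Import structures.
From mathcomp Require Import all_boot generic_quotient.
From mathcomp Require Import boolp.
From Stdlib Require List.
From Stdlib Require Import Relation_Operators Operators_Properties.

Set Implicit Arguments.
Unset Strict Implicit.
Unset Printing Implicit Defensive.
#[local] Obligation Tactic := idtac.

Declare Scope cat_scope.
Delimit Scope cat_scope with cat.
Local Open Scope cat_scope.

Record category := Category {
  obj :> Type;
  hom : obj -> obj -> Type;
  idm : forall x, hom x x;
  compm : forall x y z, hom y z -> hom x y -> hom x z;
  comp1m : forall x y (f : hom x y), compm (idm y) f = f;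
  compm1 : forall x y (f : hom x y), compm f (idm x) = f;
  compmA : forall x y z t (h : hom z t) (g : hom y z) (f : hom x y),
    compm h (compm g f) = compm (compm h g) f }.

Arguments hom {c} x y.
Arguments idm {c} x.
Arguments compm {c x y z} g f.
Notation "g ∘ f" := (compm g f) (at level 40, left associativity) : cat_scope.

Definition opposite (C : category) : category :=
  @Category C (fun x y => @hom C y x) (@idm C) (fun x y z g f => f ∘ g)
    (fun x y f => compm1 f) (fun x y f => comp1m f)
    (fun x y z t h g f => esym (compmA f g h)).

Record functor (C D : category) := Functor {
  fobj :> C -> D;
  fhom : forall x y, hom x y -> hom (fobj x) (fobj y);
  fhom1 : forall x, fhom (idm x) = idm (fobj x);
  fhomM : forall x y z (g : hom y z) (f : hom x y),
    fhom (g ∘ f) = fhom g ∘ fhom f }.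

Arguments fhom {C D} F {x y} f : rename.

Program Definition functor_comp (C D E : category)
    (G : functor D E) (F : functor C D) : functor C E :=
  {| fobj := fun x => G (F x); fhom := fun x y f => fhom G (fhom F f) |}.
Next Obligation. by move=> * /=; rewrite !fhom1. Qed.
Next Obligation. by move=> * /=; rewrite !fhomM. Qed.

Definition finite_category (J : category) : Prop :=
  (exists s : list J, forall j, List.In j s) /\
  (forall i j : J, exists s : list (hom i j), forall a, List.In a s).

Definition is_cone (J C : category) (F : functor J C) (c : C)
    (p : forall j, hom c (F j)) : Prop :=
  forall i j (a : hom i j), fhom F a ∘ p i = p j.

Arguments is_cone {J C} F {c} p.

Definition is_limit (J C : category) (F : functor J C) (c : C)
    (p : forall j, hom c (F j)) : Prop :=
  is_cone F p /\
  forall (c' : C) (p' : forall j, hom c' (F j)), is_cone F p' ->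
    exists! u : hom c' c, forall j, p j ∘ u = p' j.

Arguments is_limit {J C} F {c} p.

Definition has_finite_limits (C : category) : Prop :=
  forall (J : category) (F : functor J C), finite_category J ->
    exists (c : C) (p : forall j, hom c (F j)), is_limit F p.

Definition has_finite_colimits (C : category) : Prop :=
  has_finite_limits (opposite C).

Definition is_coproduct (C : category) (A B S : C)
    (i0 : hom A S) (i1 : hom B S) : Prop :=
  forall (Z : C) (u : hom A Z) (v : hom B Z),
    exists! w : hom S Z, w ∘ i0 = u /\ w ∘ i1 = v.

Definition is_product (C : category) (A B S : C)
    (p0 : hom S A) (p1 : hom S B) : Prop :=
  forall (Z : C) (u : hom Z A) (v : hom Z B),
    exists! w : hom Z S, p0 ∘ w = u /\ p1 ∘ w = v.

Record we_category := WeCategory {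
  we_cat :> category;
  we : forall x y : we_cat, hom x y -> Prop;
  we1 : forall x : we_cat, we (idm x);
  weM : forall (x y z : we_cat) (g : hom y z) (f : hom x y),
    we g -> we f -> we (g ∘ f) }.

Arguments we {w x y} f : rename.

Definition retract_of (C : category) (x y x' y' : C)
    (f : hom x y) (g : hom x' y') : Prop :=
  exists (i : hom x x') (r : hom x' x) (j : hom y y') (s : hom y' y),
    [/\ r ∘ i = idm x, s ∘ j = idm y, g ∘ i = j ∘ f & f ∘ r = s ∘ g].

Definition has_lifting (C : category) (a b x y : C)
    (i : hom a b) (p : hom x y) : Prop :=
  forall (u : hom a x) (v : hom b y), p ∘ u = v ∘ i ->
    exists h : hom b x, h ∘ i = u /\ p ∘ h = v.

(* The axioms of Quillen's closed model categories: only finite limits and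
   colimits are required, and factorizations need not be functorial. *)
Record model_category := ModelCategory {
  model_cat :> we_category;
  cof : forall x y : model_cat, hom x y -> Prop;
  fib : forall x y : model_cat, hom x y -> Prop;
  cof1 : forall x : model_cat, cof (idm x);
  fib1 : forall x : model_cat, fib (idm x);
  cofM : forall (x y z : model_cat) (g : hom y z) (f : hom x y),
    cof g -> cof f -> cof (g ∘ f);
  fibM : forall (x y z : model_cat) (g : hom y z) (f : hom x y),
    fib g -> fib f -> fib (g ∘ f);
  finite_limits : has_finite_limits model_cat;
  finite_colimits : has_finite_colimits model_cat;
  we_cancel_l : forall (x y z : model_cat) (g : hom y z) (f : hom x y),
    we g -> we (g ∘ f) -> we f;
  we_cancel_r : forall (x y z : model_cat) (g : hom y z) (f : hom x y),
    we f -> we (g ∘ f) -> we g;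
  we_retract : forall (x y x' y' : model_cat) (f : hom x y) (g : hom x' y'),
    retract_of f g -> we g -> we f;
  cof_retract : forall (x y x' y' : model_cat) (f : hom x y) (g : hom x' y'),
    retract_of f g -> cof g -> cof f;
  fib_retract : forall (x y x' y' : model_cat) (f : hom x y) (g : hom x' y'),
    retract_of f g -> fib g -> fib f;
  lift_tcof_fib : forall (a b x y : model_cat) (i : hom a b) (p : hom x y),
    cof i -> we i -> fib p -> has_lifting i p;
  lift_cof_tfib : forall (a b x y : model_cat) (i : hom a b) (p : hom x y),
    cof i -> fib p -> we p -> has_lifting i p;
  factor_cof_tfib : forall (x y : model_cat) (f : hom x y),
    exists (z : model_cat) (i : hom x z) (p : hom z y),
      [/\ f = p ∘ i, cof i, fib p & we p];
  factor_tcof_fib : forall (x y : model_cat) (f : hom x y),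
    exists (z : model_cat) (i : hom x z) (p : hom z y),
      [/\ f = p ∘ i, cof i, we i & fib p] }.

(* A cylinder object factors the fold map S = A ⊔ A -> A as s ∘ i with s a weak
   equivalence; i is not required to be a cofibration, so that this notion of
   homotopy contains the ones defined by good or very good cylinders.  Path
   objects are treated dually. *)
Definition is_cylinder (C : we_category) (A S Cyl : C) (in0 in1 : hom A S)
    (i : hom S Cyl) (s : hom Cyl A) : Prop :=
  [/\ is_coproduct in0 in1, we s, s ∘ i ∘ in0 = idm A & s ∘ i ∘ in1 = idm A].

Definition left_homotopic (C : we_category) (A B : C) (f g : hom A B) : Prop :=
  exists (S Cyl : C) (in0 in1 : hom A S) (i : hom S Cyl) (s : hom Cyl A)
    (H : hom Cyl B),
    [/\ is_cylinder in0 in1 i s, H ∘ i ∘ in0 = f & H ∘ i ∘ in1 = g].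

Definition is_path_object (C : we_category) (B S P : C) (pr0 pr1 : hom S B)
    (p : hom P S) (c : hom B P) : Prop :=
  [/\ is_product pr0 pr1, we c, pr0 ∘ (p ∘ c) = idm B & pr1 ∘ (p ∘ c) = idm B].

Definition right_homotopic (C : we_category) (A B : C) (f g : hom A B) : Prop :=
  exists (S P : C) (pr0 pr1 : hom S B) (p : hom P S) (c : hom B P)
    (H : hom A P),
    [/\ is_path_object pr0 pr1 p c, pr0 ∘ (p ∘ H) = f & pr1 ∘ (p ∘ H) = g].

Record mono (m n : nat) := Mono {
  mono_fun :> 'I_m.+1 -> 'I_n.+1;
  mono_homo : forall i j : 'I_m.+1, i <= j -> mono_fun i <= mono_fun j }.

Definition mono_id n : mono n n := @Mono n n id (fun _ _ h => h).

Definition mono_comp m n p (b : mono n p) (a : mono m n) : mono m p :=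
  @Mono m p (fun i => b (a i)) (fun _ _ h => mono_homo b (mono_homo a h)).

Definition mono_cst m n (k : 'I_n.+1) : mono m n :=
  @Mono m n (fun _ => k) (fun _ _ _ => leqnn k).

Record sset := SSet {
  simp :> nat -> Type;
  act : forall m n, mono m n -> simp n -> simp m;
  act1 : forall n (x : simp n), act (mono_id n) x = x;
  actM : forall m n p (b : mono n p) (a : mono m n) (x : simp p),
    act (mono_comp b a) x = act a (act b x) }.

Arguments act {s m n} a x : rename.

Record smap (K L : sset) := SMap {
  smap_fun :> forall n, K n -> L n;
  smap_act : forall m n (a : mono m n) (x : K n),
    smap_fun (act a x) = act a (smap_fun x) }.

Program Definition smap_comp (K L M : sset) (v : smap L M) (u : smap K L) :
  smap K M := {| smap_fun := fun n x => v n (u n x) |}.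
Next Obligation. by move=> * /=; rewrite !smap_act. Qed.

Program Definition delta (p : nat) : sset :=
  {| simp := fun n => mono n p; act := fun m n a b => mono_comp b a |}.
Next Obligation. by move=> p n []. Qed.
Next Obligation. by []. Qed.

Program Definition sprod (K L : sset) : sset :=
  {| simp := fun n => (K n * L n)%type;
     act := fun m n a x => (act a x.1, act a x.2) |}.
Next Obligation. by move=> K L n [x y] /=; rewrite !act1. Qed.
Next Obligation. by move=> K L m n p b a [x y] /=; rewrite !actM. Qed.

Definition strict_homotopic (K L : sset) (u v : smap K L) : Prop :=
  exists H : smap (sprod K (delta 1)) L,
    forall n (x : K n),
      H n (x, mono_cst n ord0) = u n x /\ H n (x, mono_cst n ord_max) = v n x.

Definition simplicially_homotopic (K L : sset) : smap K L -> smap K L -> Prop :=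
  clos_refl_sym_trans _ (@strict_homotopic K L).

Program Definition ordinal_cat (n : nat) : category :=
  {| obj := 'I_n.+1; hom := fun i j => is_true (i <= j);
     idm := fun i => leqnn i; compm := fun i j k h g => leq_trans g h |}.
Next Obligation. by move=> *; exact: bool_irrelevance. Qed.
Next Obligation. by move=> *; exact: bool_irrelevance. Qed.
Next Obligation. by move=> *; exact: bool_irrelevance. Qed.

Program Definition mono_functor m n (a : mono m n) :
    functor (ordinal_cat m) (ordinal_cat n) :=
  {| fobj := (a : ordinal_cat m -> ordinal_cat n);
     fhom := fun i j h => mono_homo a h |}.
Next Obligation. by move=> *; exact: bool_irrelevance. Qed.
Next Obligation. by move=> *; exact: bool_irrelevance. Qed.

Lemma functor_eq (C D : category) (F : C -> D)
    (h1 h2 : forall x y, hom x y -> hom (F x) (F y)) e1 e1' e2 e2' :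
  (forall x y f, h1 x y f = h2 x y f) ->
  @Functor C D F h1 e1 e1' = @Functor C D F h2 e2 e2'.
Proof.
move=> eqh; have E : h1 = h2.
  by apply: functional_extensionality_dep => x;
     apply: functional_extensionality_dep => y; apply: funext => f.
by case: _ / E e2 e2' => e2 e2'; congr Functor; exact: Prop_irrelevance.
Qed.

Program Definition nerve (C : category) : sset :=
  {| simp := fun n => functor (ordinal_cat n) C;
     act := fun m n a x => functor_comp x (mono_functor a) |}.
Next Obligation.
by move=> C n [F h e1 e2]; apply: functor_eq => i j f;
   congr h; exact: bool_irrelevance.
Qed.
Next Obligation.
by move=> C m n p b a [F h e1 e2]; apply: functor_eq => i j f;
   congr h; exact: bool_irrelevance.
Qed.

Program Definition nerve_map (C D : category) (F : functor C D) :
    smap (nerve C) (nerve D) := {| smap_fun := fun n x => functor_comp F x |}.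
Next Obligation. by move=> *; exact: functor_eq. Qed.

Section Quotient.
Variables (T : Type) (R : T -> T -> Prop).

Definition gen_equiv : rel {classic T} :=
  fun x y => `[< clos_refl_sym_trans T R x y >].

Lemma gen_equiv_refl : reflexive gen_equiv.
Proof. by move=> x; apply/asboolP; exact: rst_refl. Qed.

Lemma gen_equiv_sym : symmetric gen_equiv.
Proof.
by move=> x y; apply/asboolP/asboolP => h; exact: rst_sym.
Qed.

Lemma gen_equiv_trans : transitive gen_equiv.
Proof.
move=> y x z /asboolP xy /asboolP yz; apply/asboolP.
exact: rst_trans xy yz.
Qed.

Canonical gen_equiv_equiv :=
  EquivRel gen_equiv gen_equiv_refl gen_equiv_sym gen_equiv_trans.

Definition quotient : Type := {eq_quot gen_equiv}%qT.

Definition qclass (x : T) : quotient := (\pi_{eq_quot gen_equiv} x)%qT.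

Lemma qclassP (x y : T) :
  qclass x = qclass y <-> clos_refl_sym_trans T R x y.
Proof.
split=> [/eqmodP|] h; first exact/asboolP.
by apply/eqmodP/asboolP.
Qed.

Definition qlift (U : Type) (u : T -> U) (q : quotient) : U :=
  u (repr q).

Lemma qliftE (U : Type) (u : T -> U) :
  (forall x y, R x y -> u x = u y) ->
  forall x, qlift u (qclass x) = u x.
Proof.
move=> uR x; have /qclassP : qclass (repr (qclass x)) = qclass x by exact: reprK.
rewrite /qlift; move: (repr _) => y=> h.
by elim: h => [a b /uR|a|a b _ ->|a b c _ -> _ ->].
Qed.

Lemma quotientP (P : quotient -> Prop) :
  (forall x, P (qclass x)) -> forall q, P q.
Proof.
by move=> h q; have -> : q = qclass (repr q) by rewrite /qclass reprK.
Qed.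

End Quotient.

Program Definition ssum (K : nat -> sset) : sset :=
  {| simp := fun n => {k : nat & K k n};
     act := fun m n a x => existT _ (projT1 x) (act a (projT2 x)) |}.
Next Obligation. by move=> K n [k x] /=; rewrite act1. Qed.
Next Obligation. by move=> K m n p b a [k x] /=; rewrite actM. Qed.

Definition sin (K : nat -> sset) (k : nat) : smap (K k) (ssum K) :=
  @SMap (K k) (ssum K) (fun n x => existT _ k x) (fun _ _ _ _ => erefl).

Program Definition ssum_shift (K L : nat -> sset)
    (u : forall k, smap (K k) (L k.+1)) : smap (ssum K) (ssum L) :=
  {| smap_fun := fun n x => existT _ (projT1 x).+1 (u (projT1 x) n (projT2 x)) |}.
Next Obligation. by move=> K L u m n a [k x] /=; rewrite smap_act. Qed.

Record simplicial_rel (K : sset) := SimplicialRel {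
  srel :> forall n, K n -> K n -> Prop;
  srel_act : forall m n (a : mono m n) (x y : K n),
    srel x y -> srel (act a x) (act a y) }.

Section QuotientSSet.
Variables (K : sset) (R : simplicial_rel K).

Let qact m n (a : mono m n) : quotient (R n) -> quotient (R m) :=
  qlift (fun x => qclass (R m) (act a x)).

Let qactE m n (a : mono m n) x : qact a (qclass (R n) x) = qclass (R m) (act a x).
Proof.
apply: (@qliftE _ (R n) _ (fun x => qclass (R m) (act a x))) => y z yz.
by apply/qclassP; apply: rst_step; exact: srel_act.
Qed.

Program Definition squot : sset :=
  {| simp := fun n => quotient (R n); act := qact |}.
Next Obligation. by move=> n; apply: quotientP => x; rewrite qactE act1. Qed.
Next Obligation.
by move=> m n p b a; apply: quotientP => x; rewrite !qactE actM.
Qed.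

Program Definition sclass : smap K squot :=
  {| smap_fun := fun n x => qclass (R n) x |}.
Next Obligation. by move=> m n a x; rewrite /= qactE. Qed.

Section Lift.
Variables (L : sset) (u : smap K L).
Hypothesis uR : forall n (x y : K n), R n x y -> u n x = u n y.

Program Definition squot_lift : smap squot L :=
  {| smap_fun := fun n => qlift (u n) |}.
Next Obligation.
move=> m n a; apply: quotientP => x.
by rewrite /= qactE !(qliftE (@uR _)) smap_act.
Qed.

Lemma squot_liftE n (x : K n) : squot_lift n (sclass n x) = u n x.
Proof. exact: qliftE (@uR n) x. Qed.

End Lift.
End QuotientSSet.

Section SeqColim.
Variables (K : nat -> sset) (e : forall k, smap (K k) (K k.+1)).

Inductive seq_step n : ssum K n -> ssum K n -> Prop :=
  SeqStep k (x : K k n) : seq_step (sin K k n x) (sin K k.+1 n (e k n x)).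

Program Definition seq_rel : simplicial_rel (ssum K) := {| srel := seq_step |}.
Next Obligation.
by move=> m n a _ _ [k x]; rewrite -!smap_act; exact: SeqStep.
Qed.

Definition seq_colim : sset := squot seq_rel.

Definition seq_in k : smap (K k) seq_colim := smap_comp (sclass seq_rel) (sin K k).

End SeqColim.

Section Zigzag.
Variable C : we_category.
Implicit Types X Y : C.

(* The first two arrows X <- mid -> next of a zig-zag, together with the
   remaining part, a zig-zag starting at next. *)
Record zz_cons X (T : C -> Type) := Cons {
  zz_mid : C;
  zz_next : C;
  zz_back : hom zz_mid X;
  zz_back_we : we zz_back;
  zz_fwd : hom zz_mid zz_next;
  zz_tail : T zz_next }.

(* zz Y k X is the type of zig-zags from X to Y with n = 2k + 1 arrows. *)
Fixpoint zz Y (k : nat) (X : C) : Type :=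
  if k is k'.+1 then zz_cons X (zz Y k')
  else {w : hom Y X | we w}.

(* The vertical arrows between two zig-zags, except those at the two ends. *)
Fixpoint zz_maps Y k X X' : zz Y k X -> zz Y k X' -> Type :=
  if k is k'.+1 return zz Y k X -> zz Y k X' -> Type then fun z z' =>
    (hom (zz_mid z) (zz_mid z') * hom (zz_next z) (zz_next z')
       * zz_maps (zz_tail z) (zz_tail z'))%type
  else fun _ _ => unit.

(* Commutativity, with vertical arrow u at the left end, and the identity
   of Y at the right end. *)
Fixpoint zz_comm Y k X X' (u : hom X X') :
    forall (z : zz Y k X) (z' : zz Y k X'), zz_maps z z' -> Prop :=
  if k is k'.+1 return
    forall (z : zz Y k X) (z' : zz Y k X'), zz_maps z z' -> Prop
  then fun z z' m =>
    [/\ zz_back z' ∘ m.1.1 = u ∘ zz_back z,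
        zz_fwd z' ∘ m.1.1 = m.1.2 ∘ zz_fwd z &
        zz_comm m.1.2 m.2]
  else fun z z' _ => sval z' ∘ idm Y = u ∘ sval z.

Fixpoint zz_id Y k X : forall z : zz Y k X, zz_maps z z :=
  if k is k'.+1 return forall z : zz Y k X, zz_maps z z then
    fun z => (idm (zz_mid z), idm (zz_next z), zz_id (zz_tail z))
  else fun _ => tt.

Fixpoint zz_comp Y k X X' X'' : forall (z : zz Y k X) (z' : zz Y k X')
    (z'' : zz Y k X''), zz_maps z' z'' -> zz_maps z z' -> zz_maps z z'' :=
  if k is k'.+1 return forall (z : zz Y k X) (z' : zz Y k X') (z'' : zz Y k X''),
      zz_maps z' z'' -> zz_maps z z' -> zz_maps z z''
  then fun z z' z'' m' m =>
    (m'.1.1 ∘ m.1.1, m'.1.2 ∘ m.1.2, zz_comp m'.2 m.2)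
  else fun _ _ _ _ _ => tt.

Lemma zz_id_comm Y k X (z : zz Y k X) : zz_comm (idm X) (zz_id z).
Proof.
elim: k X z => [|k IH] X z /=; first by rewrite comp1m compm1.
by split; rewrite ?comp1m ?compm1.
Qed.

Lemma zz_comp_comm Y k X X' X'' (u' : hom X' X'') (u : hom X X')
    (z : zz Y k X) (z' : zz Y k X') (z'' : zz Y k X'')
    (m' : zz_maps z' z'') (m : zz_maps z z') :
  zz_comm u' m' -> zz_comm u m -> zz_comm (u' ∘ u) (zz_comp m' m).
Proof.
elim: k X X' X'' u' u z z' z'' m' m => [|k IH] X X' X'' u' u z z' z'' m' m /=.
  by rewrite !compm1 => -> ->; rewrite compmA.
move=> [b' f' t'] [b f t]; split; last exact: IH.
- by rewrite compmA b' -!compmA b.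
- by rewrite compmA f' -!compmA f.
Qed.

Lemma zz_comp1 Y k X X' (z : zz Y k X) (z' : zz Y k X') (m : zz_maps z z') :
  zz_comp (zz_id z') m = m.
Proof.
elim: k X X' z z' m => [|k IH] X X' z z' /=; first by case.
by case=> [[a b] t] /=; rewrite !comp1m IH.
Qed.

Lemma zz_comp1r Y k X X' (z : zz Y k X) (z' : zz Y k X') (m : zz_maps z z') :
  zz_comp m (zz_id z) = m.
Proof.
elim: k X X' z z' m => [|k IH] X X' z z' /=; first by case.
by case=> [[a b] t] /=; rewrite !compm1 IH.
Qed.

Lemma zz_compA Y k X1 X2 X3 X4 (z1 : zz Y k X1) (z2 : zz Y k X2)
    (z3 : zz Y k X3) (z4 : zz Y k X4) (m3 : zz_maps z3 z4)
    (m2 : zz_maps z2 z3) (m1 : zz_maps z1 z2) :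
  zz_comp m3 (zz_comp m2 m1) = zz_comp (zz_comp m3 m2) m1.
Proof.
elim: k X1 X2 X3 X4 z1 z2 z3 z4 m3 m2 m1 => [|k IH] //= *.
by rewrite !compmA IH.
Qed.

Lemma sub_eq (T : Type) (P : T -> Prop) (x y : {t : T | P t}) :
  sval x = sval y -> x = y.
Proof.
case: x y => [x px] [y py] /= e; case: _ / e py => py.
by congr exist; exact: Prop_irrelevance.
Qed.

Lemma zz_homM_comm Y k X (z z' z'' : zz Y k X)
    (m' : {m : zz_maps z' z'' | zz_comm (idm X) m})
    (m : {m : zz_maps z z' | zz_comm (idm X) m}) :
  zz_comm (idm X) (zz_comp (sval m') (sval m)).
Proof.
by case: m' m => [m' h'] [m h]; move: (zz_comp_comm h' h); rewrite comp1m.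
Qed.

(* The category written L^H_n C(X, Y), where n = 2k + 1. *)
Definition LHn (k : nat) (X Y : C) : category.
Proof.
refine (@Category (zz Y k X)
  (fun z z' => {m : zz_maps z z' | zz_comm (idm X) m})
  (fun z => exist _ (zz_id z) (zz_id_comm z))
  (fun z z' z'' m' m => exist _ (zz_comp (sval m') (sval m)) (zz_homM_comm m' m))
  _ _ _).
- by move=> z z' m; apply: sub_eq; exact: zz_comp1.
- by move=> z z' m; apply: sub_eq; exact: zz_comp1r.
- by move=> *; apply: sub_eq; exact: zz_compA.
Defined.

Section ZzFunctor.
Variables (k l : nat) (X X' Y Y' : C) (F : zz Y k X -> zz Y' l X')
  (Fm : forall z z', zz_maps z z' -> zz_maps (F z) (F z')).
Hypotheses
  (Fm_comm : forall z z' (m : zz_maps z z'),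
     zz_comm (idm X) m -> zz_comm (idm X') (Fm m))
  (Fm1 : forall z, Fm (zz_id z) = zz_id (F z))
  (FmM : forall z z' z'' (m' : zz_maps z' z'') (m : zz_maps z z'),
     Fm (zz_comp m' m) = zz_comp (Fm m') (Fm m)).

Definition zz_functor : functor (LHn k X Y) (LHn l X' Y').
Proof.
refine (@Functor (LHn k X Y) (LHn l X' Y') F
  (fun z z' m => exist _ (Fm (sval m)) (Fm_comm (svalP m))) _ _).
- by move=> z; apply: sub_eq; exact: Fm1.
- by move=> *; apply: sub_eq; exact: FmM.
Defined.

End ZzFunctor.

(* C_1 is replaced by C_1 --id--> C_1 <--id-- C_1; note that C_1 = Y when
   k = 0. *)
Definition zz_emb Y k X : zz Y k X -> zz Y k.+1 X :=
  if k is k'.+1 return zz Y k X -> zz Y k.+1 X then fun z =>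
    @Cons X (zz Y k'.+1) (zz_mid z) (zz_mid z) (zz_back z) (zz_back_we z)
      (idm (zz_mid z))
      (@Cons (zz_mid z) (zz Y k') (zz_mid z) (zz_next z)
         (idm (zz_mid z)) (we1 (zz_mid z)) (zz_fwd z) (zz_tail z))
  else fun z =>
    @Cons X (zz Y 0) Y Y (sval z) (proj2_sig z) (idm Y) (exist _ (idm Y) (we1 Y)).

Definition zz_emb_maps Y k X X' : forall (z : zz Y k X) (z' : zz Y k X'),
    zz_maps z z' -> zz_maps (zz_emb z) (zz_emb z') :=
  if k is k'.+1 return forall (z : zz Y k X) (z' : zz Y k X'),
    zz_maps z z' -> zz_maps (zz_emb z) (zz_emb z')
  then fun z z' m => (m.1.1, m.1.1, (m.1.1, m.1.2, m.2))
  else fun z z' m => (idm Y, idm Y, tt).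

Definition LHn_emb (X Y : C) (k : nat) : functor (LHn k X Y) (LHn k.+1 X Y).
Proof.
apply: (@zz_functor k k.+1 X X Y Y (@zz_emb Y k X) (@zz_emb_maps Y k X X)).
- case: k => [|k] z z' m /=; first by move=> e; split=> //=; rewrite ?comp1m.
  by move=> [b f t]; split=> //=; rewrite comp1m compm1.
- by case: k.
- by case: k => [|k] z z' z'' m' m //=; rewrite comp1m.
Defined.

Fixpoint zz_push (A B : C) (f : hom A B) k X : zz A k X -> zz B k.+1 X :=
  if k is k'.+1 return zz A k X -> zz B k.+1 X then fun z =>
    @Cons X (zz B k'.+1) (zz_mid z) (zz_next z) (zz_back z) (zz_back_we z)
      (zz_fwd z) (zz_push f (zz_tail z))
  else fun z =>
    @Cons X (zz B 0) A B (sval z) (proj2_sig z) f (exist _ (idm B) (we1 B)).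

Fixpoint zz_push_maps (A B : C) (f : hom A B) k X X' :
    forall (z : zz A k X) (z' : zz A k X'),
    zz_maps z z' -> zz_maps (zz_push f z) (zz_push f z') :=
  if k is k'.+1 return forall (z : zz A k X) (z' : zz A k X'),
    zz_maps z z' -> zz_maps (zz_push f z) (zz_push f z')
  then fun z z' m => (m.1.1, m.1.2, zz_push_maps f m.2)
  else fun z z' m => (idm A, idm B, tt).

Lemma zz_push_comm (A B : C) (f : hom A B) k X X' (u : hom X X')
    (z : zz A k X) (z' : zz A k X') (m : zz_maps z z') :
  zz_comm u m -> zz_comm u (zz_push_maps f m).
Proof.
elim: k X X' u z z' m => [|k IH] X X' u z z' m /=.
  by move=> e; split=> //=; rewrite ?comp1m ?compm1.
by move=> [b g t]; split=> //=; exact: IH.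
Qed.

Lemma zz_push_maps1 (A B : C) (f : hom A B) k X (z : zz A k X) :
  zz_push_maps f (zz_id z) = zz_id (zz_push f z).
Proof. by elim: k X z => [|k IH] //= ? z; rewrite IH. Qed.

Lemma zz_push_mapsM (A B : C) (f : hom A B) k X X' X'' (z : zz A k X)
    (z' : zz A k X') (z'' : zz A k X'') (m' : zz_maps z' z'')
    (m : zz_maps z z') :
  zz_push_maps f (zz_comp m' m) = zz_comp (zz_push_maps f m') (zz_push_maps f m).
Proof.
elim: k X X' X'' z z' z'' m' m => [|k IH] X X' X'' z z' z'' m' m /=.
  by rewrite !comp1m.
by rewrite IH.
Qed.

Definition LHn_push (X A B : C) (f : hom A B) (k : nat) :
    functor (LHn k X A) (LHn k.+1 X B) :=
  zz_functor (fun z z' m => @zz_push_comm A B f k X X (idm X) z z' m)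
    (@zz_push_maps1 A B f k X) (@zz_push_mapsM A B f k X X X).

Definition zz_pull (A B Y : C) (f : hom A B) k (z : zz Y k B) : zz Y k.+1 A :=
  @Cons A (zz Y k) A B (idm A) (we1 A) f z.

Definition zz_pull_maps (A B Y : C) (f : hom A B) k (z z' : zz Y k B)
    (m : zz_maps z z') : zz_maps (zz_pull f z) (zz_pull f z') :=
  (idm A, idm B, m).

Definition LHn_pull (A B Y : C) (f : hom A B) (k : nat) :
  functor (LHn k B Y) (LHn k.+1 A Y).
Proof.
apply: (@zz_functor k k.+1 B A Y Y (@zz_pull A B Y f k) (@zz_pull_maps A B Y f k)).
- by move=> z z' m mC; split=> //=; rewrite comp1m compm1.
- by [].
- by move=> *; rewrite /zz_pull_maps /= !comp1m.
Defined.

Definition zz_pre Y k X c (w : hom c X) (Ww : we w) : zz Y k c -> zz Y k X :=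
  if k is k'.+1 return zz Y k c -> zz Y k X then fun z =>
    @Cons X (zz Y k') (zz_mid z) (zz_next z) (w ∘ zz_back z)
      (weM Ww (zz_back_we z)) (zz_fwd z) (zz_tail z)
  else fun z => exist _ (w ∘ sval z) (weM Ww (proj2_sig z)).

Definition zz_pre_maps Y k X X' c c' (w : hom c X) (Ww : we w)
    (w' : hom c' X') (Ww' : we w') : forall (z : zz Y k c) (z' : zz Y k c'),
    zz_maps z z' -> zz_maps (zz_pre Ww z) (zz_pre Ww' z') :=
  if k is k'.+1 return forall (z : zz Y k c) (z' : zz Y k c'),
    zz_maps z z' -> zz_maps (zz_pre Ww z) (zz_pre Ww' z')
  then fun _ _ m => m else fun _ _ m => m.

(* reduces i m n : at both ends z and z' of m, the i-th arrow after the first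
   one is an identity, over which m has equal components, and n is obtained
   from m by omitting this identity and composing the two adjacent arrows,
   which point in the same direction.  For i even, the omitted arrow points
   forward and the adjacent ones backward; for i odd, the other way around. *)
Inductive reduces Y : nat -> forall k X X' (z : zz Y k.+1 X) (z' : zz Y k.+1 X')
    (m : zz_maps z z') (y : zz Y k X) (y' : zz Y k X') (n : zz_maps y y'),
    Prop :=
| ReducesFwd k X X' c c' (w : hom c X) (Ww : we w) (w' : hom c' X')
    (Ww' : we w') (r : zz Y k c) (r' : zz Y k c') (a : hom c c')
    (m : zz_maps r r') :
  @reduces Y 0 k X X'
    (@Cons X (zz Y k) c c w Ww (idm c) r)
    (@Cons X' (zz Y k) c' c' w' Ww' (idm c') r')
    (a, a, m)
    (zz_pre Ww r) (zz_pre Ww' r') (zz_pre_maps Ww Ww' m)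
| ReducesBwd k X X' b b' c c' e e' (w : hom b X) (Ww : we w) (w' : hom b' X')
    (Ww' : we w') (d : hom b c) (d' : hom b' c') (Wc : we (idm c))
    (Wc' : we (idm c')) (g : hom c e) (g' : hom c' e') (r : zz Y k e)
    (r' : zz Y k e') (a : hom b b') (h : hom c c') (t : hom e e')
    (m : zz_maps r r') :
  @reduces Y 1 k.+1 X X'
    (@Cons X (zz Y k.+1) b c w Ww d (@Cons c (zz Y k) c e (idm c) Wc g r))
    (@Cons X' (zz Y k.+1) b' c' w' Ww' d'
       (@Cons c' (zz Y k) c' e' (idm c') Wc' g' r'))
    (a, h, (h, t, m))
    (@Cons X (zz Y k) b e w Ww (g ∘ d) r)
    (@Cons X' (zz Y k) b' e' w' Ww' (g' ∘ d') r')
    (a, t, m)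
| ReducesTail i k X X' b b' c c' (w : hom b X) (Ww : we w) (w' : hom b' X')
    (Ww' : we w') (d : hom b c) (d' : hom b' c') (z : zz Y k.+1 c)
    (z' : zz Y k.+1 c') (m : zz_maps z z') (y : zz Y k c) (y' : zz Y k c')
    (n : zz_maps y y') (a : hom b b') (h : hom c c') :
  reduces i m n ->
  @reduces Y i.+2 k.+1 X X'
    (@Cons X (zz Y k.+1) b c w Ww d z)
    (@Cons X' (zz Y k.+1) b' c' w' Ww' d' z')
    (a, h, m)
    (@Cons X (zz Y k) b c w Ww d y)
    (@Cons X' (zz Y k) b' c' w' Ww' d' y')
    (a, h, n).

Lemma zz_push_reduces (A B : C) (f : hom A B) i k X X' (z : zz A k.+1 X)
    (z' : zz A k.+1 X') (m : zz_maps z z') (y : zz A k X) (y' : zz A k X')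
    (n : zz_maps y y') :
  reduces i m n -> reduces i (zz_push_maps f m) (zz_push_maps f n).
Proof.
elim=> {i k X X' z z' m y y' n}.
- case=> [|k] X X' c c' w Ww w' Ww' r r' a m.
    exact: (@ReducesFwd B 1 X X' c c' w Ww w' Ww' (zz_push f r) (zz_push f r') a
              (zz_push_maps f m)).
  exact: (@ReducesFwd B k.+2 X X' c c' w Ww w' Ww' (zz_push f r) (zz_push f r') a
              (zz_push_maps f m)).
- by move=> *; exact: ReducesBwd.
- by move=> *; exact: ReducesTail.
Qed.

Lemma emb_reduces Y k X X' (z : zz Y k X) (z' : zz Y k X') (m : zz_maps z z') :
  reduces 0 (zz_emb_maps m) m.
Proof.
case: k z z' m => [|k].
- move=> [w Ww] [w' Ww'] [] /=.
  have := ReducesFwd Ww Ww' (idm Y)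
    (tt : @zz_maps Y 0 Y Y (exist _ (idm Y) (we1 Y)) (exist _ (idm Y) (we1 Y))).
  rewrite /=; move: (weM Ww (we1 Y)) (weM Ww' (we1 Y)); rewrite !compm1 => W1 W1'.
  by rewrite (Prop_irrelevance W1 Ww) (Prop_irrelevance W1' Ww').
- move=> [b c w Ww d t] [b' c' w' Ww' d' t'] [[a h] m] /=.
  have := @ReducesFwd Y k.+1 X X' b b' w Ww w' Ww'
    (@Cons b (zz Y k) b c (idm b) (we1 b) d t)
    (@Cons b' (zz Y k) b' c' (idm b') (we1 b') d' t') a (a, h, m).
  rewrite /=; move: (weM Ww (we1 b)) (weM Ww' (we1 b')); rewrite !compm1 => W1 W1'.
  by rewrite (Prop_irrelevance W1 Ww) (Prop_irrelevance W1' Ww').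
Qed.

End Zigzag.

Section Hammock.
Variable C : we_category.

(* colim_n N L^H_n C(X, Y) *)
Definition LH (X Y : C) : sset :=
  seq_colim (fun k => nerve_map (LHn_emb X Y k)).

Lemma LHn_push_emb (X A B : C) (f : hom A B) k n (x : nerve (LHn k X A) n) :
  nerve_map (LHn_push X f k.+1) n (nerve_map (LHn_emb X A k) n x) =
  nerve_map (LHn_emb X B k.+1) n (nerve_map (LHn_push X f k) n x).
Proof. by case: k x => [|k] x; apply: functor_eq => i j a; apply: sub_eq. Qed.

Definition LH_push_pre (X A B : C) (f : hom A B) :
    smap (ssum (fun k => nerve (LHn k X A))) (LH X B) :=
  smap_comp (sclass _) (ssum_shift (fun k => nerve_map (LHn_push X f k))).

Lemma LH_push_preP (X A B : C) (f : hom A B) n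
    (x y : ssum (fun k => nerve (LHn k X A)) n) :
  seq_step (fun k => nerve_map (LHn_emb X A k)) x y ->
  LH_push_pre X f n x = LH_push_pre X f n y.
Proof.
case=> k z; apply/qclassP; apply: rst_step.
have := SeqStep (fun k => nerve_map (LHn_emb X B k)) (nerve_map (LHn_push X f k) n z).
by rewrite -LHn_push_emb.
Qed.

Definition LH_push (X A B : C) (f : hom A B) : smap (LH X A) (LH X B) :=
  @squot_lift _ (seq_rel (fun k => nerve_map (LHn_emb X A k))) _
    (LH_push_pre X f) (@LH_push_preP X A B f).

Lemma LH_push_in (X A B : C) (f : hom A B) k n (x : nerve (LHn k X A) n) :
  LH_push X f n (seq_in (fun k => nerve_map (LHn_emb X A k)) k n x) =
  seq_in (fun k => nerve_map (LHn_emb X B k)) k.+1 n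
    (nerve_map (LHn_push X f k) n x).
Proof. by rewrite /LH_push /seq_in /= (qliftE (@LH_push_preP X A B f n)). Qed.

(* The functors LHn_pull do not commute with the embeddings LHn_emb: for a
   zig-zag starting with B <- C_1, embedding before pulling back repeats C_1,
   while embedding after pulling back repeats A.  Hence the functors LHn_pull
   do not induce a map LH B Y -> LH A Y, and what they define is the following
   map on the coproduct of all the stages of the colimit LH B Y. *)
Definition LH_pull_stages (A B Y : C) (f : hom A B) :
    smap (ssum (fun k => nerve (LHn k B Y))) (LH A Y) :=
  smap_comp (sclass _) (ssum_shift (fun k => nerve_map (LHn_pull Y f k))).

(* In the hammock localization of Dwyer and Kan, two hammocks are identified
   when they differ by omitting a column of identities and composing the
   adjacent columns.  Thus C_i -id-> C_i <-id- C_i can be inserted at any C_i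
   with i odd, not only at C_1, which makes f^* and the composition by
   concatenation well defined. *)
Inductive hammock_step (X Y : C) n :
    ssum (fun k => nerve (LHn k X Y)) n ->
    ssum (fun k => nerve (LHn k X Y)) n -> Prop :=
  HammockStep i k (x : nerve (LHn k.+1 X Y) n) (y : nerve (LHn k X Y) n) :
    (forall (j j' : ordinal_cat n) (h : hom j j'),
       reduces i (sval (fhom x h)) (sval (fhom y h))) ->
    hammock_step (sin _ k.+1 n x) (sin _ k n y).

Program Definition hammock_rel (X Y : C) :
    simplicial_rel (ssum (fun k => nerve (LHn k X Y))) :=
  {| srel := @hammock_step X Y |}.
Next Obligation.
move=> X Y m n a _ _ [i k x y xy]; apply: (@HammockStep X Y m i) => j j' h.
exact: xy.
Qed.

Definition DKH (X Y : C) : sset := squot (hammock_rel X Y).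

Definition DKH_push_pre (X A B : C) (f : hom A B) :
    smap (ssum (fun k => nerve (LHn k X A))) (DKH X B) :=
  smap_comp (sclass _) (ssum_shift (fun k => nerve_map (LHn_push X f k))).

Lemma DKH_push_preP (X A B : C) (f : hom A B) n
    (x y : ssum (fun k => nerve (LHn k X A)) n) :
  hammock_rel X A n x y -> DKH_push_pre X f n x = DKH_push_pre X f n y.
Proof.
case=> i k {}x {}y xy; apply/qclassP; apply: rst_step.
apply: (@HammockStep X B n i) => j j' h; exact: zz_push_reduces.
Qed.

Definition DKH_push (X A B : C) (f : hom A B) : smap (DKH X A) (DKH X B) :=
  @squot_lift _ (hammock_rel X A) _ (DKH_push_pre X f) (@DKH_push_preP X A B f).

Definition DKH_pull_pre (A B Y : C) (f : hom A B) :
    smap (ssum (fun k => nerve (LHn k B Y))) (DKH A Y) :=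
  smap_comp (sclass _) (ssum_shift (fun k => nerve_map (LHn_pull Y f k))).

Lemma DKH_pull_preP (A B Y : C) (f : hom A B) n
    (x y : ssum (fun k => nerve (LHn k B Y)) n) :
  hammock_rel B Y n x y -> DKH_pull_pre Y f n x = DKH_pull_pre Y f n y.
Proof.
case=> i k {}x {}y xy; apply/qclassP; apply: rst_step.
apply: (@HammockStep A Y n i.+2) => j j' h; exact: ReducesTail.
Qed.

Definition DKH_pull (A B Y : C) (f : hom A B) : smap (DKH B Y) (DKH A Y) :=
  @squot_lift _ (hammock_rel B Y) _ (DKH_pull_pre Y f) (@DKH_pull_preP A B Y f).

Lemma DKH_push_in (X A B : C) (f : hom A B) k n (x : nerve (LHn k X A) n) :
  DKH_push X f n (sclass (hammock_rel X A) n (sin _ k n x)) =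
  sclass (hammock_rel X B) n (sin _ k.+1 n (nerve_map (LHn_push X f k) n x)).
Proof. by rewrite /DKH_push /= (qliftE (@DKH_push_preP X A B f n)). Qed.

Lemma DKH_pull_in (A B Y : C) (f : hom A B) k n (x : nerve (LHn k B Y) n) :
  DKH_pull Y f n (sclass (hammock_rel B Y) n (sin _ k n x)) =
  sclass (hammock_rel A Y) n (sin _ k.+1 n (nerve_map (LHn_pull Y f k) n x)).
Proof. by rewrite /DKH_pull /= (qliftE (@DKH_pull_preP A B Y f n)). Qed.

(* The reductions include the identifications made in LH. *)
Lemma hammock_step_emb (X Y : C) k n (x : nerve (LHn k X Y) n) :
  sclass (hammock_rel X Y) n
    (sin _ k.+1 n (nerve_map (LHn_emb X Y k) n x)) =
  sclass (hammock_rel X Y) n (sin _ k n x).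
Proof.
apply/qclassP; apply: rst_step; apply: (@HammockStep X Y n 0) => j j' h.
exact: emb_reduces.
Qed.

End Hammock.

(* Main.v *)
(* Concatenation with the zig-zags A <- M -> N <- B is a functor in both
   arguments, hence a pairing of simplicial sets K x N(L^H_3 C(A, B)) -> L for
   (K, L) = (L^H C(X, A), L^H C(X, B)) and (L^H C(B, Y), L^H C(A, Y)).  At the
   zig-zag [f] := (A = A -f-> B = B) it is f_*, respectively f^*, and a morphism
   of zig-zags gives a strict homotopy.  A left homotopy H on a cylinder
   s : Cyl -> A gives morphisms [f] -> (A <-s- Cyl -H-> B = B) <- [g], whose
   components at A are the two inclusions into Cyl; a right homotopy H into a
   path object c : B -> P gives [f] <- (A = A -H-> P <-c- B) -> [g]. *)

From mathcomp Require Import all_boot boolp.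
From Stdlib Require Import Relation_Operators Eqdep.
Require Import Defs.

Set Implicit Arguments.
Unset Strict Implicit.
Unset Printing Implicit Defensive.
#[local] Obligation Tactic := idtac.
Local Open Scope cat_scope.

(** * Product categories, constant functors and their nerves *)

Lemma smap_eq (K L : sset) (u v : smap K L) :
  (forall n x, u n x = v n x) -> u = v.
Proof.
case: u v => [u uA] [v vA] /= uv; have E : u = v.
  by apply: functional_extensionality_dep => n; apply: funext => x.
by case: _ / E vA => vA; congr SMap; exact: Prop_irrelevance.
Qed.

Program Definition prod_category (C D : category) : category :=
  {| obj := (C * D)%type;
     hom := fun x y => (hom x.1 y.1 * hom x.2 y.2)%type;
     idm := fun x => (idm x.1, idm x.2);
     compm := fun x y z g f => (g.1 ∘ f.1, g.2 ∘ f.2) |}.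
Next Obligation. by move=> C D x y [f g]; rewrite /= !comp1m. Qed.
Next Obligation. by move=> C D x y [f g]; rewrite /= !compm1. Qed.
Next Obligation. by move=> *; rewrite /= !compmA. Qed.

Program Definition pair_functor (J C D : category) (F : functor J C)
    (G : functor J D) : functor J (prod_category C D) :=
  {| fobj := fun j => ((F j, G j) : prod_category C D);
     fhom := fun i j a => (fhom F a, fhom G a) |}.
Next Obligation. by move=> *; rewrite /= !fhom1. Qed.
Next Obligation. by move=> *; rewrite /= !fhomM. Qed.

Program Definition nerve_pair (C D : category) :
    smap (sprod (nerve C) (nerve D)) (nerve (prod_category C D)) :=
  {| smap_fun := fun n x => pair_functor x.1 x.2 |}.
Next Obligation. by move=> *; exact: functor_eq. Qed.

Program Definition cst_functor (J C : category) (c : C) : functor J C :=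
  {| fobj := fun=> c; fhom := fun _ _ _ => idm c |}.
Next Obligation. by []. Qed.
Next Obligation. by move=> *; rewrite comp1m. Qed.

(** * A morphism as a 1-simplex of the nerve *)

Section Edge.
Variables (C : category) (a b : C) (u : hom a b).

Let edge_obj (s : bool) : C := if s then b else a.

(** The two objects of the ordinal [1] are encoded by the boolean [0 < i] and its arrows by
    implications, so that a plain match defines the functor and the case from [true] to [false] is
    absurd. *)
Let edge_hom (s t : bool) : (s -> t) -> hom (edge_obj s) (edge_obj t) :=
  match s, t return (s -> t) -> hom (edge_obj s) (edge_obj t) with
  | false, false => fun=> idm a
  | false, true => fun=> u
  | true, false => fun h => False_rect _ (notF (h isT))
  | true, true => fun=> idm b
  end.

Let edge_hom1 (s : bool) (h : s -> s) : edge_hom h = idm (edge_obj s).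
Proof. by case: s h. Qed.

Let edge_homM (s t r : bool) (h : s -> r) (h2 : t -> r) (h1 : s -> t) :
  edge_hom h = edge_hom h2 ∘ edge_hom h1.
Proof.
case: s t r h h2 h1 => [] [] [] h h2 h1; rewrite /= ?comp1m ?compm1 //;
  by [case: (notF (h isT)) | case: (notF (h1 isT)) | case: (notF (h2 isT))].
Qed.

Program Definition edge : functor (ordinal_cat 1) C :=
  {| fobj := fun i => edge_obj (0 < i);
     fhom := fun i j h => edge_hom (fun h0 : 0 < i => leq_trans h0 h) |}.
Next Obligation. by move=> i; exact: edge_hom1. Qed.
Next Obligation. by move=> *; exact: edge_homM. Qed.

Lemma edge0 n :
  @act (nerve C) _ _ (mono_cst n ord0) edge = cst_functor (ordinal_cat n) a.
Proof. exact: functor_eq. Qed.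

Lemma edge1 n :
  @act (nerve C) _ _ (mono_cst n ord_max) edge = cst_functor (ordinal_cat n) b.
Proof. exact: functor_eq. Qed.

End Edge.

(** * Homotopies from pairings with a nerve *)

Section Pairing.
Variables (K L : sset) (E : category) (c : smap (sprod K (nerve E)) L).

Program Definition pairing_at (e : E) : smap K L :=
  {| smap_fun := fun n x => c n (x, cst_functor (ordinal_cat n) e) |}.
Next Obligation.
move=> e m n a x; rewrite -smap_act /=; congr (c m (_, _)); exact: functor_eq.
Qed.

(** The edge [u] of the nerve amounts to a map from [delta 1] to it; restricting the pairing along
    this map gives the homotopy. *)
Lemma pairing_strict_homotopic (e e' : E) (u : hom e e') :
  strict_homotopic (pairing_at e) (pairing_at e').
Proof.
(* Naturality of (x, t) ↦ c(x, t^* u), where t^* u is the restriction of the edge along t. *)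
have HA m n (a : mono m n) (x : sprod K (delta 1) n) :
    c m ((act a x).1, @act (nerve E) _ _ (act a x).2 (edge u)) =
    act a (c n (x.1, @act (nerve E) _ _ x.2 (edge u))).
  by rewrite -smap_act /=; congr (c m (_, _)); exact: functor_eq.
exists (SMap HA) => n x /=; split; congr (c n (_, _)).
- exact: edge0.
- exact: edge1.
Qed.

(** Both relations are generated equivalences, so it suffices to treat a single morphism. *)
Lemma pairing_homotopic (e e' : E) :
  clos_refl_sym_trans E (fun a b => inhabited (hom a b)) e e' ->
  simplicially_homotopic (pairing_at e) (pairing_at e').
Proof.
elim=> [a b [u]|a|a b _ IH|a b d _ IH1 _ IH2].
- by apply: rst_step; exact: pairing_strict_homotopic u.
- exact: rst_refl.
- exact: rst_sym.
- exact: rst_trans IH1 IH2.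
Qed.

End Pairing.

(** * Pairings defined on coproducts and quotients *)

Program Definition sprod_mapl (K K' M : sset) (u : smap K K') :
    smap (sprod K M) (sprod K' M) :=
  {| smap_fun := fun n x => (u n x.1, x.2) |}.
Next Obligation. by move=> *; rewrite /= smap_act. Qed.
Arguments sprod_mapl {K K'} M u.

Program Definition ssum_pairing (K : nat -> sset) (M L : sset)
    (c : forall k, smap (sprod (K k) M) L) : smap (sprod (ssum K) M) L :=
  {| smap_fun := fun n x => c (projT1 x.1) n (projT2 x.1, x.2) |}.
Next Obligation. by move=> K M L c m n a [[k x] y] /=; rewrite -smap_act. Qed.

Section SquotPairing.
Variables (K M L : sset) (R : simplicial_rel K) (c : smap (sprod K M) L).
Hypothesis cR : forall n (x y : K n) (z : M n), R n x y -> c n (x, z) = c n (y, z).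

(** The relation concerns the first variable only, so each simplex of [M] can be held fixed while
    lifting to the quotient. *)
Program Definition squot_pairing : smap (sprod (squot R) M) L :=
  {| smap_fun := fun n x => qlift (fun y => c n (y, x.2)) x.1 |}.
Next Obligation.
move=> m n a [q z]; move: q; apply: quotientP => x.
have qE k (w : K k) (y : M k) :
    qlift (fun v => c k (v, y)) (qclass (R k) w) = c k (w, y).
  by apply: (qliftE (u := fun v => c k (v, y))) => v v' /cR.
have E : @act (squot R) _ _ a (qclass (R n) x) = qclass (R m) (act a x).
  exact/esym/(smap_act (sclass R)).
(* The action on the quotient is made explicit, so that [E] can evaluate it on a class. *)
rewrite -[LHS]/(qlift (fun v => c m (v, act a z))
  (@act (squot R) _ _ a (qclass (R n) x))) E.
by rewrite /= !qE -smap_act.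
Qed.

Lemma squot_pairingE n (x : K n) (z : M n) :
  squot_pairing n (sclass R n x, z) = c n (x, z).
Proof. by apply: (qliftE (u := fun v => c n (v, z))) => v v' /cR. Qed.

End SquotPairing.

(** * Concatenation with zig-zags of three arrows *)

Section Concatenation.
Variable C : we_category.

(** Only the first square changes: it is pasted with the square formed by [w], [w'], [u] and [v]. *)
Lemma zz_pre_comm (Y : C) k (X X' c c' : C) (w : hom c X) (Ww : we w)
    (w' : hom c' X') (Ww' : we w') (u : hom X X') (v : hom c c')
    (z : zz Y k c) (z' : zz Y k c') (m : zz_maps z z') :
  w' ∘ v = u ∘ w -> zz_comm v m -> zz_comm u (zz_pre_maps Ww Ww' m).
Proof.
case: k z z' m => [|k] z z' m wv /=.
  by move=> e; rewrite -compmA e !compmA wv.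
by case=> [e1 e2 e3]; split=> //; rewrite -compmA e1 !compmA wv.
Qed.

Lemma zz_pre_maps1 (Y : C) k (X c : C) (w : hom c X) (Ww : we w)
    (z : zz Y k c) :
  zz_pre_maps Ww Ww (zz_id z) = zz_id (zz_pre Ww z).
Proof. by case: k z. Qed.

Lemma zz_pre_mapsM (Y : C) k (X X' X'' c c' c'' : C) (w : hom c X) (Ww : we w)
    (w' : hom c' X') (Ww' : we w') (w'' : hom c'' X'') (Ww'' : we w'')
    (z : zz Y k c) (z' : zz Y k c') (z'' : zz Y k c'')
    (m' : zz_maps z' z'') (m : zz_maps z z') :
  zz_pre_maps Ww Ww'' (zz_comp m' m) =
  zz_comp (zz_pre_maps Ww' Ww'' m') (zz_pre_maps Ww Ww' m).
Proof. by case: k z z' z'' m' m. Qed.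

(** Two adjacent backward arrows are composed at the joint, so 2k + 1 and 3 arrows give 2(k + 1) +
    1. *)
Fixpoint zz_rcat (A B : C) (e : zz B 1 A) k X : zz A k X -> zz B k.+1 X :=
  if k is k'.+1 return zz A k X -> zz B k.+1 X then fun z =>
    @Cons C X (zz B k'.+1) (zz_mid z) (zz_next z) (zz_back z) (zz_back_we z)
      (zz_fwd z) (zz_rcat e (zz_tail z))
  else fun z => zz_pre (proj2_sig z) e.

Fixpoint zz_rcat_maps (A B : C) (e e' : zz B 1 A) (c : zz_maps e e') k X X' :
    forall (z : zz A k X) (z' : zz A k X'),
    zz_maps z z' -> zz_maps (zz_rcat e z) (zz_rcat e' z') :=
  if k is k'.+1 return forall (z : zz A k X) (z' : zz A k X'),
    zz_maps z z' -> zz_maps (zz_rcat e z) (zz_rcat e' z')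
  then fun z z' m => (m.1.1, m.1.2, zz_rcat_maps c m.2)
  else fun z z' m => zz_pre_maps (proj2_sig z) (proj2_sig z') c.

Lemma zz_rcat_comm (A B : C) (e e' : zz B 1 A) (c : zz_maps e e') k (X X' : C)
    (u : hom X X') (z : zz A k X) (z' : zz A k X') (m : zz_maps z z') :
  zz_comm (idm A) c -> zz_comm u m -> zz_comm u (zz_rcat_maps c m).
Proof.
move=> cC; elim: k X X' u z z' m => [|k IH] X X' u z z' m.
  (* For k = 0, commutativity of [m] is the square along which [c] is glued, with the identity of A
     as its right side. *)
  by move=> e1; apply: zz_pre_comm cC.
by case=> e1 e2 e3; split=> //; exact: IH.
Qed.

Lemma zz_rcat_maps1 (A B : C) (e : zz B 1 A) k (X : C) (z : zz A k X) :
  zz_rcat_maps (zz_id e) (zz_id z) = zz_id (zz_rcat e z).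
Proof.
elim: k X z => [|k IH] X z; first exact: zz_pre_maps1.
by congr (_, _); exact: IH.
Qed.

Lemma zz_rcat_mapsM (A B : C) (e e' e'' : zz B 1 A) (c' : zz_maps e' e'')
    (c : zz_maps e e') k (X X' X'' : C) (z : zz A k X) (z' : zz A k X')
    (z'' : zz A k X'') (m' : zz_maps z' z'') (m : zz_maps z z') :
  zz_rcat_maps (zz_comp c' c) (zz_comp m' m) =
  zz_comp (zz_rcat_maps c' m') (zz_rcat_maps c m).
Proof.
elim: k X X' X'' z z' z'' m' m => [|k IH] X X' X'' z z' z'' m' m.
  exact: zz_pre_mapsM.
by congr (_, _); exact: IH.
Qed.

Definition LHn_rcat (X A B : C) k :
  functor (prod_category (LHn k X A) (LHn 1 A B)) (LHn k.+1 X B).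
Proof.
refine (@Functor (prod_category (LHn k X A) (LHn 1 A B)) (LHn k.+1 X B)
  (fun z => zz_rcat (z.2 : zz B 1 A) (z.1 : zz A k X))
  (fun z z' m => exist _ (zz_rcat_maps (sval m.2) (sval m.1))
     (zz_rcat_comm (svalP m.2) (svalP m.1))) _ _).
- by move=> z; apply: sub_eq; exact: zz_rcat_maps1.
- by move=> z z' z'' g f; apply: sub_eq; exact: zz_rcat_mapsM.
Defined.

Definition zz_lcat (A B Y : C) k (e : zz B 1 A) (z : zz Y k B) : zz Y k.+1 A :=
  @Cons C A (zz Y k) (zz_mid e) (zz_next e) (zz_back e) (zz_back_we e)
    (zz_fwd e) (zz_pre (proj2_sig (zz_tail e)) z).

Definition zz_lcat_maps (A B Y : C) k (e e' : zz B 1 A) (c : zz_maps e e')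
    (z z' : zz Y k B) (m : zz_maps z z') :
    zz_maps (zz_lcat e z) (zz_lcat e' z') :=
  (c.1.1, c.1.2, zz_pre_maps (proj2_sig (zz_tail e)) (proj2_sig (zz_tail e')) m).

Lemma zz_lcat_comm (A B Y : C) k (e e' : zz B 1 A) (c : zz_maps e e')
    (z z' : zz Y k B) (m : zz_maps z z') :
  zz_comm (idm A) c -> zz_comm (idm B) m -> zz_comm (idm A) (zz_lcat_maps c m).
Proof.
case=> c1 c2 c3 mC; split=> //; apply: zz_pre_comm mC; exact: c3.
Qed.

Definition LHn_lcat (A B Y : C) k :
  functor (prod_category (LHn k B Y) (LHn 1 A B)) (LHn k.+1 A Y).
Proof.
refine (@Functor (prod_category (LHn k B Y) (LHn 1 A B)) (LHn k.+1 A Y)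
  (fun z => zz_lcat (z.2 : zz B 1 A) (z.1 : zz Y k B))
  (fun z z' m => exist _ (zz_lcat_maps (sval m.2) (sval m.1))
     (zz_lcat_comm (svalP m.2) (svalP m.1))) _ _).
- by move=> z; apply: sub_eq; rewrite /= /zz_lcat_maps zz_pre_maps1.
- move=> z z' z'' g f; apply: sub_eq; rewrite /= /zz_lcat_maps /=.
  by congr (_, _); exact: zz_pre_mapsM.
Defined.

(* Equality of maps whose sources and targets are equal only propositionally. *)
Inductive zz_maps_eq (Y : C) k (X X' : C) (z : zz Y k X) (z' : zz Y k X')
    (m : zz_maps z z') :
    forall (y : zz Y k X) (y' : zz Y k X'), zz_maps y y' -> Prop :=
  ZzMapsEq : zz_maps_eq m m.

(** * Equality of maps of zig-zags over equal ends *)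

(** Read as an equality of nested dependent pairs, the hypothesis yields the result by applying
    [inj_pair2] twice, that is, by uniqueness of identity proofs. *)
Lemma zz_maps_eqE (Y : C) k (X X' : C) (z : zz Y k X) (z' : zz Y k X')
    (m n : zz_maps z z') : zz_maps_eq m n -> m = n.
Proof.
have E y y' (p : zz_maps y y') : zz_maps_eq m p ->
    existT (fun z => {z' : zz Y k X' & zz_maps z z'}) z (existT _ z' m) =
    existT _ y (existT _ y' p) by case.
by move=> mn; exact: inj_pair2 (inj_pair2 _ _ _ _ _ (E _ _ _ mn)).
Qed.

Lemma zz_maps_eq_sym (Y : C) k (X X' : C) (z y : zz Y k X) (z' y' : zz Y k X')
    (m : zz_maps z z') (n : zz_maps y y') : zz_maps_eq m n -> zz_maps_eq n m.
Proof. by case. Qed.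

(** Comparing morphisms is enough: [zz_maps_eq] at an identity already forces the objects to
    agree. *)
Lemma LHn_functor_eq (J : category) k (X Y : C) (F G : functor J (LHn k X Y)) :
  (forall i j (a : hom i j), zz_maps_eq (sval (fhom F a)) (sval (fhom G a))) ->
  F = G.
Proof.
case: F G => [F Fh F1 FM] [G Gh G1 GM] /= FG; have E : F = G.
  by apply: funext => j; case: (FG j j (idm j)).
case: _ / E Gh G1 GM FG => Gh G1 GM FG; apply: functor_eq => i j a.
by apply: sub_eq; exact: zz_maps_eqE.
Qed.

(** Allows a backward arrow to be replaced by an equal one, the proofs of weak equivalence being
    irrelevant. *)
Lemma zz_maps_eq_cons (Y : C) k (X X' b b' c c' : C) (w v : hom b X)
    (Ww : we w) (Wv : we v) (w' v' : hom b' X') (Ww' : we w') (Wv' : we v')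
    (d : hom b c) (d' : hom b' c') (z y : zz Y k c) (z' y' : zz Y k c')
    (a : hom b b') (h : hom c c') (m : zz_maps z z') (n : zz_maps y y') :
  w = v -> w' = v' -> zz_maps_eq m n ->
  zz_maps_eq
    ((a, h, m) : @zz_maps C Y k.+1 X X' (Cons Ww d z) (Cons Ww' d' z'))
    ((a, h, n) : @zz_maps C Y k.+1 X X' (Cons Wv d y) (Cons Wv' d' y')).
Proof.
move=> wv; case: _ / wv Wv => Wv; rewrite (Prop_irrelevance Wv Ww).
move=> wv'; case: _ / wv' Wv' => Wv'; rewrite (Prop_irrelevance Wv' Ww').
by case.
Qed.

Lemma zz_maps_eq_base (Y X X' : C) (w v : hom Y X) (Ww : we w) (Wv : we v)
    (w' v' : hom Y X') (Ww' : we w') (Wv' : we v') (m n : unit) :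
  w = v -> w' = v' ->
  zz_maps_eq
    (m : @zz_maps C Y 0 X X' (exist _ w Ww) (exist _ w' Ww'))
    (n : @zz_maps C Y 0 X X' (exist _ v Wv) (exist _ v' Wv')).
Proof.
move=> wv; case: _ / wv Wv => Wv; rewrite (Prop_irrelevance Wv Ww).
move=> wv'; case: _ / wv' Wv' => Wv'; rewrite (Prop_irrelevance Wv' Ww').
by case: m n => [] [].
Qed.

(** Unit law of composition into the first arrow, followed by its associativity; both come from the
    propositional laws of [C], whence the use of [zz_maps_eq]. *)
Lemma zz_pre_maps_id (Y : C) k (X X' : C) (W : we (idm X)) (W' : we (idm X'))
    (z : zz Y k X) (z' : zz Y k X') (m : zz_maps z z') :
  zz_maps_eq (zz_pre_maps W W' m) m.
Proof.
case: k z z' m => [|k].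
  by move=> [w Ww] [w' Ww'] m; apply: zz_maps_eq_base; rewrite comp1m.
move=> [b c w Ww d t] [b' c' w' Ww' d' t'] [[a h] m].
by apply: zz_maps_eq_cons; rewrite ?comp1m.
Qed.

Lemma zz_pre_maps_comp (Y : C) k (X X' b b' c c' : C)
    (w : hom b X) (Ww : we w) (w' : hom b' X') (Ww' : we w')
    (v : hom c b) (Wv : we v) (v' : hom c' b') (Wv' : we v')
    (z : zz Y k c) (z' : zz Y k c') (m : zz_maps z z') :
  zz_maps_eq (zz_pre_maps Ww Ww' (zz_pre_maps Wv Wv' m))
    (zz_pre_maps (weM Ww Wv) (weM Ww' Wv') m).
Proof.
case: k z z' m => [|k].
  by move=> [u Wu] [u' Wu'] m; apply: zz_maps_eq_base; rewrite compmA.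
move=> [b1 c1 u Wu d t] [b1' c1' u' Wu' d' t'] [[a h] m].
by apply: zz_maps_eq_cons; rewrite ?compmA.
Qed.

(** * Compatibility of concatenation with reductions *)

Lemma reduces_eq (Y : C) i k (X X' : C) (z : zz Y k.+1 X)
    (z' : zz Y k.+1 X') (m : zz_maps z z') (y : zz Y k X) (y' : zz Y k X')
    (n : zz_maps y y') (x : zz Y k X) (x' : zz Y k X') (p : zz_maps x x') :
  reduces i m n -> zz_maps_eq n p -> reduces i m p.
Proof. by move=> mn; case. Qed.

(** The omitted identity survives concatenation on the right. The two orders of composition differ
    only when the omission and the joint meet at the same backward arrow, and there associativity
    settles it. *)
Lemma zz_rcat_reduces (A B : C) (e e' : zz B 1 A) (c : zz_maps e e') i k
    (X X' : C) (z : zz A k.+1 X) (z' : zz A k.+1 X') (m : zz_maps z z')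
    (y : zz A k X) (y' : zz A k X') (n : zz_maps y y') :
  reduces i m n -> reduces i (zz_rcat_maps c m) (zz_rcat_maps c n).
Proof.
elim=> {i k X X' z z' m y y' n}.
- case=> [|k] X X' b b' w Ww w' Ww' r r' a m.
    apply: (reduces_eq (@ReducesFwd C B 1 X X' b b' w Ww w' Ww'
      (zz_rcat e r) (zz_rcat e' r') a (zz_rcat_maps c m))).
    exact: zz_pre_maps_comp.
  exact: (@ReducesFwd C B k.+2 X X' b b' w Ww w' Ww' (zz_rcat e r)
    (zz_rcat e' r') a (zz_rcat_maps c m)).
- by move=> *; exact: ReducesBwd.
- by move=> *; exact: ReducesTail.
Qed.

(** Only a reduction at position 0 affects the first arrow; it then agrees with the composition with
    [v] by associativity. *)
Lemma zz_pre_reduces (Y : C) i k (b b' X X' : C) (v : hom b X) (Wv : we v)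
    (v' : hom b' X') (Wv' : we v') (z : zz Y k.+1 b) (z' : zz Y k.+1 b')
    (m : zz_maps z z') (y : zz Y k b) (y' : zz Y k b') (n : zz_maps y y') :
  reduces i m n -> reduces i (zz_pre_maps Wv Wv' m) (zz_pre_maps Wv Wv' n).
Proof.
move=> mn; case: mn v Wv v' Wv' => {i k b b' z z' m y y' n}.
- move=> k b b' d d' w Ww w' Ww' r r' a m v Wv v' Wv'.
  apply: reduces_eq (ReducesFwd (weM Wv Ww) (weM Wv' Ww') a m) _.
  exact/zz_maps_eq_sym/zz_pre_maps_comp.
- by move=> *; exact: ReducesBwd.
- by move=> *; exact: ReducesTail.
Qed.

(** * Concatenation with the zig-zag of a single morphism *)

Definition zz_arrow (A B : C) (f : hom A B) : zz B 1 A :=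
  @Cons C A (zz B 0) A B (idm A) (we1 A) f (exist _ (idm B) (we1 B)).

(** The two sides differ in the last backward arrow of the given zig-zag, which concatenation
    composes with the identity of A. *)
Lemma zz_rcat_maps_arrow (A B : C) (f : hom A B) k (X X' : C) (z : zz A k X)
    (z' : zz A k X') (m : zz_maps z z') :
  zz_maps_eq (zz_rcat_maps (zz_id (zz_arrow f)) m) (zz_push_maps f m).
Proof.
elim: k X X' z z' m => [|k IH] X X' z z' m.
  by apply: zz_maps_eq_cons; rewrite ?compm1.
exact: zz_maps_eq_cons.
Qed.

Lemma LHn_rcat_arrow (X A B : C) (f : hom A B) k n (x : nerve (LHn k X A) n) :
  nerve_map (LHn_rcat X A B k) n
    (nerve_pair _ _ n (x, cst_functor _ (zz_arrow f : LHn 1 A B))) =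
  nerve_map (LHn_push X f k) n x.
Proof.
by apply: LHn_functor_eq => i j a; exact: zz_rcat_maps_arrow.
Qed.

Lemma LHn_lcat_arrow (A B Y : C) (f : hom A B) k n (x : nerve (LHn k B Y) n) :
  nerve_map (LHn_lcat A B Y k) n
    (nerve_pair _ _ n (x, cst_functor _ (zz_arrow f : LHn 1 A B))) =
  nerve_map (LHn_pull Y f k) n x.
Proof.
apply: LHn_functor_eq => i j a; apply: zz_maps_eq_cons => //.
exact: zz_pre_maps_id.
Qed.

End Concatenation.

(** * The pairings on the hammock localizations *)

Section Pairings.
Variables (C : we_category) (A B : C).

Definition stage_pairing (X Y Z W : C) k l
    (F : functor (prod_category (LHn k X Y) (LHn 1 A B)) (LHn l Z W)) :
    smap (sprod (nerve (LHn k X Y)) (nerve (LHn 1 A B))) (nerve (LHn l Z W)) :=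
  smap_comp (nerve_map F) (nerve_pair _ _).

Definition rcat_pairing (X : C) k := stage_pairing (LHn_rcat X A B k).
Definition lcat_pairing (Y : C) k := stage_pairing (LHn_lcat A B Y k).

(* LHn_rcat commutes with the embeddings except at k = 0: there the last arrow
   X <- A is also the first one, and for e = (A <-s- M -> N <- B), embedding
   first repeats A while embedding last repeats M.  Embedding once more before
   concatenating avoids this stage. *)
Definition LH_rcat_stage (X : C) k :
    smap (sprod (nerve (LHn k X A)) (nerve (LHn 1 A B))) (LH X B) :=
  smap_comp (seq_in (fun k => nerve_map (LHn_emb X B k)) k.+2)
    (smap_comp (rcat_pairing X k.+1) (sprod_mapl _ (nerve_map (LHn_emb X A k)))).

Definition LH_rcat_pre (X : C) := ssum_pairing (LH_rcat_stage X).

(** From stage 1 on, the embedding acts at the left end and the concatenation at the right end, so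
    both sides agree on objects by computation. *)
Lemma rcat_pairing_emb (X : C) k n (x : nerve (LHn k.+1 X A) n)
    (e : nerve (LHn 1 A B) n) :
  rcat_pairing X k.+2 n (nerve_map (LHn_emb X A k.+1) n x, e) =
  nerve_map (LHn_emb X B k.+2) n (rcat_pairing X k.+1 n (x, e)).
Proof. by apply: functor_eq => i j a; apply: sub_eq. Qed.

Lemma seq_in_emb (X Y : C) k n (x : nerve (LHn k X Y) n) :
  seq_in (fun k => nerve_map (LHn_emb X Y k)) k.+1 n (nerve_map (LHn_emb X Y k) n x) =
  seq_in (fun k => nerve_map (LHn_emb X Y k)) k n x.
Proof.
apply/esym/qclassP; apply: rst_step.
exact: (SeqStep (fun k => nerve_map (LHn_emb X Y k))).
Qed.

Lemma LH_rcat_preP (X : C) n (x y : ssum (fun k => nerve (LHn k X A)) n)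
    (e : nerve (LHn 1 A B) n) :
  seq_rel (fun k => nerve_map (LHn_emb X A k)) n x y ->
  LH_rcat_pre X n (x, e) = LH_rcat_pre X n (y, e).
Proof.
case=> k z; apply/esym.
(* Here [z] is embedded twice before concatenation; the outer embedding moves past the concatenation
   and is absorbed by the colimit. *)
rewrite -[LHS]/(seq_in _ k.+3 n (rcat_pairing X k.+2 n
  (nerve_map (LHn_emb X A k.+1) n (nerve_map (LHn_emb X A k) n z), e))).
by rewrite rcat_pairing_emb seq_in_emb.
Qed.

Definition LH_rcat (X : C) : smap (sprod (LH X A) (nerve (LHn 1 A B))) (LH X B) :=
  squot_pairing (@LH_rcat_preP X).

Lemma LH_rcat_arrow (X : C) (f : hom A B) :
  pairing_at (LH_rcat X) (zz_arrow f : LHn 1 A B) = LH_push X f.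
Proof.
apply: smap_eq => n; apply: quotientP => -[k x].
rewrite -[LHS]/(LH_rcat X n (sclass (seq_rel (fun k => nerve_map (LHn_emb X A k))) n
  (sin (fun k => nerve (LHn k X A)) k n x), cst_functor _ (zz_arrow f : LHn 1 A B))).
rewrite squot_pairingE -[RHS]/(LH_push X f n
  (seq_in (fun k => nerve_map (LHn_emb X A k)) k n x)) LH_push_in.
(* The colimit supplies on the right the extra embedding built into [LH_rcat_stage]. *)
by rewrite -seq_in_emb -LHn_push_emb -LHn_rcat_arrow.
Qed.

(** Defined on the coproduct of the stages, because concatenation on the left does not commute with
    the embeddings, as for [LH_pull_stages]. *)
Definition LH_lcat_stages (Y : C) :
    smap (sprod (ssum (fun k => nerve (LHn k B Y))) (nerve (LHn 1 A B))) (LH A Y) :=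
  ssum_pairing (fun k => smap_comp
    (seq_in (fun k => nerve_map (LHn_emb A Y k)) k.+1) (lcat_pairing Y k)).

Lemma LH_lcat_stages_arrow (Y : C) (f : hom A B) :
  pairing_at (LH_lcat_stages Y) (zz_arrow f : LHn 1 A B) = LH_pull_stages Y f.
Proof.
apply: smap_eq => n [k x].
by rewrite -[RHS]/(seq_in _ k.+1 n (nerve_map _ n x)) -LHn_lcat_arrow.
Qed.

Definition DKH_rcat_pre (X : C) :
    smap (sprod (ssum (fun k => nerve (LHn k X A))) (nerve (LHn 1 A B))) (DKH X B) :=
  ssum_pairing (fun k => smap_comp
    (smap_comp (sclass (hammock_rel X B)) (sin _ k.+1)) (rcat_pairing X k)).

Lemma DKH_rcat_preP (X : C) n (x y : ssum (fun k => nerve (LHn k X A)) n)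
    (e : nerve (LHn 1 A B) n) :
  hammock_rel X A n x y -> DKH_rcat_pre X n (x, e) = DKH_rcat_pre X n (y, e).
Proof.
case=> i k {}x {}y xy; apply/qclassP; apply: rst_step.
(* Concatenation on the right leaves the position of the omitted identity unchanged. *)
apply: (@HammockStep C X B n i) => j j' h.
exact: (zz_rcat_reduces _ (xy _ _ h)).
Qed.

Definition DKH_rcat (X : C) :
    smap (sprod (DKH X A) (nerve (LHn 1 A B))) (DKH X B) :=
  squot_pairing (@DKH_rcat_preP X).

Lemma DKH_rcat_arrow (X : C) (f : hom A B) :
  pairing_at (DKH_rcat X) (zz_arrow f : LHn 1 A B) = DKH_push X f.
Proof.
apply: smap_eq => n; apply: quotientP => -[k x].
rewrite -[LHS]/(DKH_rcat X n (sclass (hammock_rel X A) n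
  (sin (fun k => nerve (LHn k X A)) k n x), cst_functor _ (zz_arrow f : LHn 1 A B))).
rewrite squot_pairingE.
rewrite -[RHS]/(DKH_push X f n (sclass (hammock_rel X A) n
  (sin (fun k => nerve (LHn k X A)) k n x))).
by rewrite DKH_push_in -LHn_rcat_arrow.
Qed.

Definition DKH_lcat_pre (Y : C) :
    smap (sprod (ssum (fun k => nerve (LHn k B Y))) (nerve (LHn 1 A B))) (DKH A Y) :=
  ssum_pairing (fun k => smap_comp
    (smap_comp (sclass (hammock_rel A Y)) (sin _ k.+1)) (lcat_pairing Y k)).

Lemma DKH_lcat_preP (Y : C) n (x y : ssum (fun k => nerve (LHn k B Y)) n)
    (e : nerve (LHn 1 A B) n) :
  hammock_rel B Y n x y -> DKH_lcat_pre Y n (x, e) = DKH_lcat_pre Y n (y, e).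
Proof.
case=> i k {}x {}y xy; apply/qclassP; apply: rst_step.
(* Concatenation on the left puts two more arrows in front, which shifts the position by 2. *)
apply: (@HammockStep C A Y n i.+2) => j j' h.
by apply: ReducesTail; exact: (zz_pre_reduces _ _ (xy _ _ h)).
Qed.

Definition DKH_lcat (Y : C) :
    smap (sprod (DKH B Y) (nerve (LHn 1 A B))) (DKH A Y) :=
  squot_pairing (@DKH_lcat_preP Y).

Lemma DKH_lcat_arrow (Y : C) (f : hom A B) :
  pairing_at (DKH_lcat Y) (zz_arrow f : LHn 1 A B) = DKH_pull Y f.
Proof.
apply: smap_eq => n; apply: quotientP => -[k x].
rewrite -[LHS]/(DKH_lcat Y n (sclass (hammock_rel B Y) n
  (sin (fun k => nerve (LHn k B Y)) k n x), cst_functor _ (zz_arrow f : LHn 1 A B))).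
rewrite squot_pairingE.
rewrite -[RHS]/(DKH_pull Y f n (sclass (hammock_rel B Y) n
  (sin (fun k => nerve (LHn k B Y)) k n x))).
by rewrite DKH_pull_in -LHn_lcat_arrow.
Qed.

End Pairings.

(** * Left and right homotopies as morphisms of zig-zags *)

(** The equations are the squares of [zz_comm], freed of the identities at A and B. *)
Lemma LHn1_hom (C : we_category) (A B M N M' N' : C) (s : hom M A) (Ws : we s)
    (h : hom M N) (r : hom B N) (Wr : we r) (s' : hom M' A) (Ws' : we s')
    (h' : hom M' N') (r' : hom B N') (Wr' : we r') (a : hom M M') (b : hom N N') :
  s' ∘ a = s -> h' ∘ a = b ∘ h -> b ∘ r = r' ->
  inhabited (@hom (LHn 1 A B) (@Cons C A (zz B 0) M N s Ws h (exist _ r Wr))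
                              (@Cons C A (zz B 0) M' N' s' Ws' h' (exist _ r' Wr'))).
Proof.
move=> e1 e2 e3; split.
exists ((a, b, tt) : @zz_maps C B 1 A A (Cons Ws h _) (Cons Ws' h' _)).
by split; rewrite /= ?comp1m ?compm1.
Qed.

Lemma homotopic_zz_arrow (C : model_category) (A B : C) (f g : hom A B) :
  left_homotopic f g \/ right_homotopic f g ->
  clos_refl_sym_trans (LHn 1 A B) (fun e e' => inhabited (hom e e'))
    (zz_arrow f) (zz_arrow g).
Proof.
case.
- move=> [S [M [in0 [in1 [i [s [H [[_ Ws s0 s1] Hf Hg]]]]]]]].
  apply: (rst_trans _ _ _ (@Cons C A (zz B 0) M B s Ws H (exist _ (idm B) (we1 B)))).
    (* The inclusion [i ∘ in0] is a section of [s] and restricts [H] to [f]. *)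
    apply: rst_step; apply: (LHn1_hom _ _ _ _ _ (a := i ∘ in0) (b := idm B)).
    + by rewrite compmA.
    + by rewrite compmA comp1m.
    + by rewrite comp1m.
  (* The zig-zag of [g] also maps into the one of the cylinder, so this arrow is traversed
     backwards. *)
  apply: rst_sym; apply: rst_step.
  apply: (LHn1_hom _ _ _ _ _ (a := i ∘ in1) (b := idm B)).
  + by rewrite compmA.
  + by rewrite compmA comp1m.
  + by rewrite comp1m.
- move=> [S [P [pr0 [pr1 [p [c [H [[_ Wc c0 c1] Hf Hg]]]]]]]].
  apply: (rst_trans _ _ _ (@Cons C A (zz B 0) A P (idm A) (we1 A) H (exist _ c Wc))).
    apply: rst_sym; apply: rst_step.
    (* Dually, [pr0 ∘ p] is a retraction of [c] and carries [H] to [f]; the arrows now leave the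
       middle zig-zag. *)
    apply: (LHn1_hom _ _ _ _ _ (a := idm A) (b := pr0 ∘ p)).
    + by rewrite comp1m.
    + by rewrite compm1 -compmA.
    + by rewrite -compmA.
  apply: rst_step; apply: (LHn1_hom _ _ _ _ _ (a := idm A) (b := pr1 ∘ p)).
  + by rewrite comp1m.
  + by rewrite compm1 -compmA.
  + by rewrite -compmA.
Qed.

Theorem theorem3p1 (C : model_category) (A B : C) (f g : hom A B)
    (fg : left_homotopic f g \/ right_homotopic f g) :
  (forall X : C, simplicially_homotopic (LH_push X f) (LH_push X g)) /\
  (forall Y : C, simplicially_homotopic (LH_pull_stages Y f) (LH_pull_stages Y g)) /\
  (forall X : C, simplicially_homotopic (DKH_push X f) (DKH_push X g)) /\
  (forall Y : C, simplicially_homotopic (DKH_pull Y f) (DKH_pull Y g)).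
Proof.
have fg' := homotopic_zz_arrow fg; split; [|split; [|split]] => Z.
- by rewrite -!LH_rcat_arrow; exact: pairing_homotopic.
- by rewrite -!LH_lcat_stages_arrow; exact: pairing_homotopic.
- by rewrite -!DKH_rcat_arrow; exact: pairing_homotopic.
- by rewrite -!DKH_lcat_arrow; exact: pairing_homotopic.
Qed.
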